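(* Let $K$ be an algebraically closed field of characteristic zero, $l\in\mathbb{N}$, let $m,n\in\mathbb{N}$ be coprime with $m,n>1$, and let $P,Q\in L^{(l)}$ with $$[P,Q]\in K^\times\quad\text{and}\quad \frac{v_{1,1}(P)}{v_{1,1}(Q)}=\frac{v_{0,1}(P)}{v_{0,1}(Q)}=\frac mn .$$ Take $T_0\in K[P,Q]$ and set $T_j:=[T_{j-1},P]$ for $j\ge1$. Assume that $(\rho_0,\sigma_0)\in\mathfrak{V}_{\ge0}$ satisfies: (1) $(\rho_0,\sigma_0)\in\mathrm{Dir}(P)$ and $v_{\rho_0,\sigma_0}(P)>0$; (2) $\mathrm{st}_{\rho_0,\sigma_0}(T_j)\sim\mathrm{st}_{\rho_0,\sigma_0}(P)$ for all $j$ with $T_j\ne0$; (3) $\frac1m\mathrm{st}_{\rho_0,\sigma_0}(P)=\frac1n\mathrm{st}_{\rho_0,\sigma_0}(Q)\in\frac1l\mathbb{Z}\times\mathbb{N}$; (4) $b<a/l$, where $(a/l,b):=\frac1m\mathrm{st}_{\rho_0,\sigma_0}(P)$. Let $I_1:=[(0,-1),(\rho_0,\sigma_0)]$ and $$(\tilde\rho,\tilde\sigma):=\min\{(\rho,\sigma)\in\mathrm{Dir}(P)\cap I_1: v_{\rho',\sigma'}(P)>0\text{ for all }(\rho_0,\sigma_0)\ge(\rho',\sigma')\ge(\rho,\sigma)\}.$$ Then for all $(\rho,\sigma)\in\mathfrak{V}$ with $(\tilde\rho,\tilde\sigma)\le(\rho,\sigma)<(\rho_0,\sigma_0)$ and all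 $j\ge0$ we have $$[\ell_{\rho,\sigma}(T_j),\ell_{\rho,\sigma}(P)]=0\quad\text{and}\quad\frac{v_{\rho,\sigma}(T_j)}{v_{\rho,\sigma}(P)}=\frac{v_{\rho_0,\sigma_0}(T_j)}{v_{\rho_0,\sigma_0}(P)}.$$
   Context: $\mathbb{N}$ is the set of positive integers. $L^{(l)}=K[x^{1/l},x^{-1/l},y]$, and $[P,Q]:=\partial_xP\,\partial_yQ-\partial_xQ\,\partial_yP$ for $P,Q\in L^{(l)}$. $K[P,Q]$ is the $K$-subalgebra generated by $P,Q$. Directions: $\mathfrak{V}=\{(\rho,\sigma)\in\mathbb{Z}^2:\gcd(\rho,\sigma)=1\}$, $\mathfrak{V}_{\ge0}=\{(\rho,\sigma)\in\mathfrak{V}:\rho+\sigma\ge0\}$. Identifying a direction with its unit vector in $S^1$, an interval in $\mathfrak{V}$ is the preimage of an arc that is not the whole circle, ordered increasingly counterclockwise; $[A,B]$ is the closed arc going counterclockwise from $A$ to $B$, and the inequalities in the claim refer to the order of $I_1$. For $(\rho,\sigma)\in\mathfrak{V}$ and $P=\sum a_{i/l,j}x^{i/l}y^j\ne0$: $\mathrm{Supp}(P)=\{(i/l,j):a_{i/l,j}\neq0\}$, $v_{\rho,\sigma}(i/l,j)=\rho i/l+\sigma j$, $v_{\rho,\sigma}(P)=\max v_{\rho,\sigma}$ over $\mathrm{Supp}(P)$, and $\ell_{\rho,\sigma}(P)$ is the sum of the terms of $P$ attaining this maximum; $v_{\rho,\sigma}(0)=-\infty$, $\ell_{\rho,\sigma}(0)=0$.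 $\mathrm{Dir}(P)=\{(\rho,\sigma)\in\mathfrak{V}:\#\mathrm{Supp}(\ell_{\rho,\sigma}(P))>1\}$. The cross product is $(a_1,a_2)\times(b_1,b_2)=a_1b_2-a_2b_1$, and $A\sim B$ means $A\times B=0$. If $\ell_{\rho,\sigma}(P)$ is a monomial, $\mathrm{st}_{\rho,\sigma}(P)=\mathrm{en}_{\rho,\sigma}(P)$ is its exponent; otherwise they are the two endpoints of the segment spanned by $\mathrm{Supp}(\ell_{\rho,\sigma}(P))$, ordered so that $(\rho,\sigma)\times(\mathrm{en}_{\rho,\sigma}(P)-\mathrm{st}_{\rho,\sigma}(P))>0$. *)

(* Defs.v *)
From HB Require Import structures.
From mathcomp Require Import all_boot all_order all_algebra.
From mathcomp Require Import ring lra.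
From mathcomp Require Import finmap monalg constructive_ereal.

Set Implicit Arguments.
Unset Strict Implicit.
Unset Printing Implicit Defensive.

Import Order.TTheory GRing.Theory Num.Theory.

Local Open Scope fset_scope.
Local Open Scope ring_scope.

(* [laurent K l] is K[x^(1/l), x^(-1/l), y]; the exponent (i, j) : int * nat
   stands for the monomial x^(i/l) y^j.  The algebra structure that the monoid
   algebras {malg K[M]} carry is not available here, because it asks that M have
   no invertible element but its unit; the product is therefore built below. *)
Definition laurent (K : fieldType) (l : nat) := {malg K[(int * nat)%type]}.

HB.instance Definition _ (K : fieldType) (l : nat) :=
  GRing.Lmodule.on (laurent K l).

Section LaurentAlgebra.

Variables (K : fieldType) (l : nat).

Implicit Types (P Q : laurent K l) (e : int * nat) (c : K).

Definition lmul P Q : laurent K l :=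
  \sum_(e1 <- msupp P) \sum_(e2 <- msupp Q) << P@_e1 * Q@_e2 *g e1 + e2 >>.

Definition lone : laurent K l := << 1 *g 0 >>.

Lemma lmulw (d1 d2 : {fset int * nat}) P Q :
  msupp P `<=` d1 -> msupp Q `<=` d2 ->
  lmul P Q = \sum_(e1 <- d1) \sum_(e2 <- d2) << P@_e1 * Q@_e2 *g e1 + e2 >>.
Proof.
move=> le_d1 le_d2; rewrite /lmul (big_fset_incl _ le_d1) /=.
  apply/eq_bigr=> e1 _; apply/big_fset_incl => // e _ /mcoeff_outdom ->.
  by rewrite mulr0 monalgU0.
move=> e _ /mcoeff_outdom Pe.
by rewrite big1 => // e' _; rewrite Pe mul0r monalgU0.
Qed.

Lemma lmulC : commutative lmul.
Proof.
move=> P Q; rewrite /lmul exchange_big; apply/eq_bigr=> e1 _.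
by apply/eq_bigr=> e2 _; rewrite mulrC addrC.
Qed.

Lemma lmul0l : left_zero 0 lmul.
Proof. by move=> P; rewrite /lmul msupp0 big_seq_fset0. Qed.

Lemma lmulDl : left_distributive lmul +%R.
Proof.
move=> P1 P2 Q.
rewrite (lmulw (msuppD_le _ _) (fsubset_refl _)).
rewrite (lmulw (fsubsetUl _ (msupp P2)) (fsubset_refl _)).
rewrite (lmulw (fsubsetUr (msupp P1) _) (fsubset_refl _)).
rewrite -big_split /=; apply/eq_bigr=> e1 _.
rewrite -big_split /=; apply/eq_bigr=> e2 _.
by rewrite mcoeffD mulrDl monalgUD.
Qed.

Lemma lmulDr : right_distributive lmul +%R.
Proof. by move=> P Q1 Q2; rewrite ![lmul P _]lmulC lmulDl. Qed.

Lemma lmul0r : right_zero 0 lmul.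
Proof. by move=> P; rewrite lmulC lmul0l. Qed.

Lemma lmulUl c e P :
  lmul << c *g e >> P = \sum_(e' <- msupp P) << c * P@_e' *g e + e' >>.
Proof.
rewrite (lmulw msuppU_le (fsubset_refl _)) big_seq_fset1.
by apply/eq_bigr => e' _; rewrite mcoeffUU.
Qed.

Lemma lmulUU c1 c2 e1 e2 :
  lmul << c1 *g e1 >> << c2 *g e2 >> = << c1 * c2 *g e1 + e2 >>.
Proof. by rewrite (lmulw msuppU_le msuppU_le) !big_seq_fset1 !mcoeffUU. Qed.

Lemma lmul_suml (I : Type) (r : seq I) (F : I -> laurent K l) Q :
  lmul (\sum_(i <- r) F i) Q = \sum_(i <- r) lmul (F i) Q.
Proof. exact: (big_morph (lmul^~ Q) (fun _ _ => lmulDl _ _ _) (lmul0l _)). Qed.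

Lemma lmul_sumr (I : Type) (r : seq I) (F : I -> laurent K l) P :
  lmul P (\sum_(i <- r) F i) = \sum_(i <- r) lmul P (F i).
Proof. exact: (big_morph (lmul P) (fun _ _ => lmulDr _ _ _) (lmul0r _)). Qed.

Lemma lmulA : associative lmul.
Proof.
have UUA c1 c2 c3 e1 e2 e3 :
    lmul << c1 *g e1 >> (lmul << c2 *g e2 >> << c3 *g e3 >>) = lmul (lmul << c1 *g e1 >> << c2 *g e2 >>) << c3 *g e3 >>.
  by rewrite !lmulUU mulrA addrA.
move=> P1 P2 P3; rewrite (monalgE P1) (monalgE P2) (monalgE P3).
move: (msupp P1) (msupp P2) (msupp P3) => d1 d2 d3.
set S2 := \sum_(i <- d2) _; set S3 := \sum_(i <- d3) _.
rewrite lmul_suml [lmul (\sum_(i <- d1) _) S2]lmul_suml lmul_suml.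
apply/eq_bigr=> e1 _; rewrite [lmul S2 S3]lmul_suml lmul_sumr.
rewrite [lmul _ S2]lmul_sumr lmul_suml.
apply/eq_bigr=> e2 _; rewrite [lmul _ S3 in LHS]lmul_sumr [LHS]lmul_sumr.
by rewrite [RHS]lmul_sumr; apply/eq_bigr=> e3 _.
Qed.

Lemma lmul1l : left_id lone lmul.
Proof.
move=> P; rewrite lmulUl [RHS]monalgE.
by apply/eq_bigr=> e _; rewrite mul1r add0r.
Qed.

Lemma lone_neq0 : lone != 0.
Proof. by rewrite monalgU_eq0 oner_eq0. Qed.

HB.instance Definition _ := GRing.Zmodule_isComNzRing.Build (laurent K l)
  lmulA lmulC lmul1l lmulDl lone_neq0.

Lemma lscaleAl c P Q : c *: (P * Q) = (c *: P) * Q.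
Proof.
have lE c' (R : laurent K l) : c' *: R = lmul << c' *g 0 >> R.
  by rewrite lmulUl; apply/eq_bigr=> e _; rewrite add0r.
by rewrite !lE; apply: lmulA.
Qed.

HB.instance Definition _ := GRing.Lmodule_isLalgebra.Build K (laurent K l)
  lscaleAl.
HB.instance Definition _ := GRing.Lalgebra_isComAlgebra.Build K (laurent K l).

End LaurentAlgebra.

Section Jacobian.

Variables (K : fieldType) (l : nat).

Implicit Types (P Q T : laurent K l).

(* d/dx (x^(i/l) y^j) = (i/l) x^((i-l)/l) y^j *)
Definition derx P : laurent K l :=
  \sum_(e <- msupp P) << (e.1%:~R / l%:R) * P@_e *g (e.1 - l%:Z, e.2) >>.

(* The truncation in j.-1 is harmless: the coefficient vanishes for j = 0. *)
Definition dery P : laurent K l :=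
  \sum_(e <- msupp P) << e.2%:R * P@_e *g (e.1, e.2.-1) >>.

Definition jac P Q : laurent K l := derx P * dery Q - dery P * derx Q.

Definition iter_jac T P (j : nat) : laurent K l := iter j (jac^~ P) T.

End Jacobian.

Inductive subalg_gen (K : fieldType) (A : algType K) (P Q : A) : A -> Prop :=
| subalg_gen_scalar c : subalg_gen P Q c%:A
| subalg_gen_l : subalg_gen P Q P
| subalg_gen_r : subalg_gen P Q Q
| subalg_gen_add S T :
    subalg_gen P Q S -> subalg_gen P Q T -> subalg_gen P Q (S + T)
| subalg_gen_mul S T :
    subalg_gen P Q S -> subalg_gen P Q T -> subalg_gen P Q (S * T).

(* [rat^o] is rat as a module over itself, so that points can be scaled. *)
Definition point := (rat^o * rat^o)%type.

Definition cross (a b : point) : rat := a.1 * b.2 - a.2 * b.1.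
Definition dot (a b : point) : rat := a.1 * b.1 + a.2 * b.2.

Definition vec (d : int * int) : point := (d.1%:~R, d.2%:~R).

Definition is_dir (d : int * int) : bool := coprimez d.1 d.2.
Definition is_dir_ge0 (d : int * int) : bool := is_dir d && (0 <= d.1 + d.2).

(* For nonzero A, B, let theta(B) in [0, 2 pi) be the counterclockwise angle from
   A to B.  [angle_lt_pi A B] says theta(B) < pi, and [angle_le A B C] says
   theta(B) <= theta(C). *)
Definition angle_lt_pi (A B : int * int) : bool :=
  let a := vec A in let b := vec B in
  (0 < cross a b) || (cross a b == 0) && (0 < dot a b).

Definition angle_le (A B C : int * int) : bool :=
  if angle_lt_pi A B then angle_lt_pi A C ==> (0 <= cross (vec B) (vec C))
  else ~~ angle_lt_pi A C && (0 <= cross (vec B) (vec C)).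

(* The closed arc [A, B]; its order is [angle_le A]. *)
Definition arc (A B d : int * int) : bool := is_dir d && angle_le A d B.

Section NewtonPolygon.

Variables (K : fieldType) (l : nat).

Implicit Types (P : laurent K l) (d : int * int).

Definition pt (e : int * nat) : point := (e.1%:~R / l%:R, e.2%:R).

Definition Supp P : {fset point} := [fset pt e | e in msupp P].

Definition wt d (a : point) : rat := d.1%:~R * a.1 + d.2%:~R * a.2.

Definition val_dir d P : \bar rat :=
  \big[maxe/-oo%E]_(a <- Supp P) (wt d a)%:E.

Definition lead_dir d P : laurent K l :=
  \sum_(e <- msupp P | (wt d (pt e))%:E == val_dir d P) << P@_e *g e >>.

Definition Dir P d : bool := is_dir d && (1 < #|` Supp (lead_dir d P)|)%N.

(* The support of [lead_dir d P] lies on a line orthogonal to d, on which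
   a |-> d x a is injective: the endpoints of the segment it spans are its first
   and last points for that order (see [st_en_monom] and [st_enP]). *)
Definition sorted_lead d P : seq point :=
  sort (relpre (cross (vec d)) <=%R) (Supp (lead_dir d P)).

Definition st d P : point := head 0 (sorted_lead d P).
Definition en d P : point := last 0 (sorted_lead d P).

Lemma st_en_monom d P a :
  Supp (lead_dir d P) = [fset a] -> st d P = a /\ en d P = a.
Proof.
rewrite /st /en /sorted_lead => ->.
have : perm_eq [fset a] [:: a].
  by apply: uniq_perm => // x; rewrite ?fset_uniq // !inE.
by move=> /perm_small_eq -> //.
Qed.

Lemma mcoeff_lead d P e :
  (lead_dir d P)@_e = if (wt d (pt e))%:E == val_dir d P then P@_e else 0.
Proof.
rewrite /lead_dir (raddf_sum (mcoeff e)) /=.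
under eq_bigr => e' _ do rewrite mcoeffU.
have [eP|/mcoeff_outdom eP] := boolP (e \in msupp P); last first.
  rewrite big1 ?eP ?if_same // => e' _.
  by case: eqP => [->|_]; rewrite ?eP ?mulr0n.
rewrite big_mkcond /= (big_fsetD1 e) //= eqxx mulr1n big1_fset ?addr0 // => e'.
by rewrite !inE => /andP[/negPf -> _] _; rewrite mulr0n if_same.
Qed.

Lemma wt_lead d P a : a \in Supp (lead_dir d P) -> (wt d a)%:E = val_dir d P.
Proof.
move=> /imfsetP[/= e + ->]; rewrite -mcoeff_neq0 mcoeff_lead.
by case: ifP => [/eqP //|_]; rewrite eqxx.
Qed.

Lemma orth_eq (x y a1 a2 b1 b2 : rat) :
  x * b1 + y * b2 = x * a1 + y * a2 ->
  (a1 - b1) * (x ^+ 2 + y ^+ 2) = (x * (a2 - b2) - y * (a1 - b1)) * - y /\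
  (a2 - b2) * (x ^+ 2 + y ^+ 2) = (x * (a2 - b2) - y * (a1 - b1)) * x.
Proof.
move/eqP; rewrite -subr_eq0 => /eqP w0.
split; apply/eqP; rewrite -subr_eq0; apply/eqP.
  by transitivity (- x * (x * b1 + y * b2 - (x * a1 + y * a2)));
    [ring | rewrite w0 mulr0].
by transitivity (- y * (x * b1 + y * b2 - (x * a1 + y * a2)));
    [ring | rewrite w0 mulr0].
Qed.

Lemma st_enP d P : Dir P d ->
  [/\ st d P \in Supp (lead_dir d P), en d P \in Supp (lead_dir d P),
      0 < cross (vec d) (en d P - st d P) &
      forall a, a \in Supp (lead_dir d P) ->
        exists2 t : rat, 0 <= t <= 1 & a = st d P + t *: (en d P - st d P)].
Proof.
case/andP=> dd gt1.
pose S := Supp (lead_dir d P); pose r := sorted_lead d P.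
have memr a : (a \in r) = (a \in S) by rewrite mem_sort.
have sz : (1 < size r)%N by rewrite size_sort.
have ur : uniq r by rewrite sort_uniq fset_uniq.
have sr : sorted (relpre (cross (vec d)) <=%R) r.
  by apply: sort_sorted => a b; apply: le_total.
have d2 : 0 < d.1%:~R ^+ 2 + d.2%:~R ^+ 2 :> rat.
  rewrite lt_neqAle addr_ge0 ?sqr_ge0 // andbT eq_sym paddr_eq0 ?sqr_ge0 //.
  rewrite !sqrf_eq0 !intr_eq0; apply: contraL dd => /andP[/eqP d1 /eqP d2].
  by rewrite /is_dir d1 d2.
pose c := cross (vec d).
have cB a b : c (a - b) = c a - c b by rewrite /c /cross /=; ring.
have perp a b : a \in S -> b \in S -> a - b =
    (c (a - b) / (d.1%:~R ^+ 2 + d.2%:~R ^+ 2)) *: ((- d.2%:~R, d.1%:~R) : point).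
  move=> /wt_lead wa /wt_lead; rewrite -wa => -[].
  rewrite /c /cross /vec /wt; case: a {wa} => a1 a2; case: b => b1 b2 /= wab.
  have dn0 : (d.1%:~R ^+ 2 + d.2%:~R ^+ 2 : rat) != 0 by rewrite gt_eqF.
  congr pair; rewrite -[LHS](mulfK dn0) -[RHS]mulrAC; congr (_ / _).
    exact: (orth_eq wab).1.
  exact: (orth_eq wab).2.
have rP a : a \in S -> c (st d P) <= c a <= c (en d P).
  rewrite -memr => ar; have tr : transitive (relpre c <=%R).
    by move=> x y z; apply: le_trans.
  rewrite /st /en -/r; case: (r) ar sr => //= x s ax sx; apply/andP; split.
    move: ax; rewrite inE => /predU1P[-> //|as_].
    by have /allP/(_ _ as_) := order_path_min tr sx.
  elim: s x a sx ax => [|y s IH] x a /=; first by rewrite inE => _ /eqP ->.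
  case/andP=> xy sy; rewrite inE => /predU1P[->|]; last exact: IH.
  by apply: le_trans xy _; apply: IH; rewrite ?inE ?eqxx.
have stS : st d P \in S.
  by rewrite -memr /st -/r; case: (r) sz => //= x s _; rewrite inE eqxx.
have enS : en d P \in S.
  by rewrite -memr /en -/r; case: (r) sz => //= x s _; rewrite mem_last.
have ne : c (en d P - st d P) != 0.
  apply: contraTneq ur => c0.
  have := perp _ _ enS stS; rewrite c0 mul0r scale0r => /eqP.
  rewrite subr_eq0 /st /en -/r; case: (r) sz => [|x [|y s]] //= _ /eqP <-.
  by rewrite mem_last.
have ltse : 0 < c (en d P - st d P).
  by rewrite lt_neqAle eq_sym ne cB subr_ge0; case/andP: (rP _ stS).
split=> // a aS; exists (c (a - st d P) / c (en d P - st d P)).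
  case/andP: (rP _ aS) => le1 le2.
  rewrite divr_ge0 ?(ltW ltse) ?cB ?subr_ge0 //= ler_pdivrMr -?cB //.
  by rewrite mul1r !cB lerD2r.
have scK (u v w : rat) (q : point) : v != 0 ->
    (u / v) *: ((v / w) *: q) = (u / w) *: q.
  move=> vn0; rewrite scalerA; congr (_ *: _).
  by change (u / v * (v / w) = u / w); rewrite mulrA divfK.
by rewrite {2}(perp _ _ enS stS) scK // -perp // addrC subrK.
Qed.

End NewtonPolygon.

Arguments val_dir {K l} d%_R P%_R.
Arguments lead_dir {K l} d%_R P%_R.

(* [pos_down_to] is the set of all d in Dir(P) on the arc [(0,-1), d0] such that
   v_{d'}(P) > 0 for every d' with d <= d' <= d0; [is_min_pos dt] says that dt
   is its minimum. *)
Section Minimum.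

Variables (K : fieldType) (l : nat) (P : laurent K l) (d0 : int * int).

Definition pos_down_to (d : int * int) : Prop :=
  [/\ Dir P d, arc (0, -1) d0 d &
      forall d', is_dir d' ->
        angle_le (0, -1) d d' -> angle_le (0, -1) d' d0 -> (0 < val_dir d' P)%E].

Definition is_min_pos (dt : int * int) : Prop :=
  pos_down_to dt /\ forall d, pos_down_to d -> angle_le (0, -1) dt d.

End Minimum.

(* Main.v *)
(* Write T_j for the iterated brackets and lam_j = v_{d0}(T_j) / v_{d0}(P).  The
   point A = st_{d0}(P) lies strictly below the diagonal, so the quotient
   (rho + sigma) / v_d(P) is strictly smaller at every d on the arc than at d0.
   If v_d(T_j) = lam_j v_d(P) for all j, then [l_d(T_j), l_d(P)] = 0: otherwise
   v_d(T_{j+1}) = v_d(T_j) + v_d(P) - (rho + sigma), making lam_{j+1} larger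
   than the bound lam_j + 1 - (rho0 + sigma0) / v_{d0}(P) obtained at d0.
   Conversely, a vanishing bracket at d makes the starting points of T_j and P
   proportional, with ratio lam_j, and this preserves v(T_j) = lam_j v(P) when d
   turns clockwise up to the next direction where two exponents of the supports
   exchange their order.  There are finitely many such directions because ad(P)
   is locally nilpotent on K[P, Q], so that almost all T_j vanish. *)
Require Import Defs.
From mathcomp Require Import all_boot all_order all_algebra.
From mathcomp Require Import ring lra zify.
From mathcomp Require Import finmap monalg constructive_ereal.

Set Implicit Arguments.
Unset Strict Implicit.
Unset Printing Implicit Defensive.

Import Order.TTheory GRing.Theory Num.Theory.

Local Open Scope fset_scope.
Local Open Scope ring_scope.

Section Leibniz.

Variables (R : comPzRingType) (D : R -> R).
Hypothesis DD : {morph D : x y / x + y}.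

Definition leibniz_at x y := D (x * y) = D x * y + x * D y.

Lemma leibniz_atDl x y z :
  leibniz_at x z -> leibniz_at y z -> leibniz_at (x + y) z.
Proof. by rewrite /leibniz_at mulrDl !DD => -> ->; ring. Qed.

Lemma leibniz_atDr x y z :
  leibniz_at x y -> leibniz_at x z -> leibniz_at x (y + z).
Proof. by rewrite /leibniz_at mulrDr !DD => -> ->; ring. Qed.

End Leibniz.

Section Bracket.

Variables (R : comPzRingType) (D1 D2 : R -> R).
Hypotheses (D1D : {morph D1 : x y / x + y}) (D2D : {morph D2 : x y / x + y}).
Hypotheses (D1M : forall x y, leibniz_at D1 x y).
Hypotheses (D2M : forall x y, leibniz_at D2 x y).

Definition bracket x y := D1 x * D2 y - D2 x * D1 y.

Lemma bracketDl z : {morph bracket^~ z : x y / x + y}.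
Proof. by move=> x y; rewrite /bracket D1D D2D; ring. Qed.

Lemma bracketC x y : bracket x y = - bracket y x.
Proof. by rewrite /bracket; ring. Qed.

Lemma bracketDr z : {morph bracket z : x y / x + y}.
Proof. by move=> x y; rewrite /bracket D1D D2D; ring. Qed.

Lemma bracketxx x : bracket x x = 0.
Proof. by rewrite /bracket; ring. Qed.

Lemma bracketMl x y z : bracket (x * y) z = bracket x z * y + x * bracket y z.
Proof. by rewrite /bracket D1M D2M; ring. Qed.

End Bracket.

Section JacobianAlgebra.

Variables (K : fieldType) (l : nat).
Implicit Types (P Q S T : laurent K l) (e f : int * nat) (c : K).

Lemma laurent_ind (p : laurent K l -> Prop) :
  (forall c e, p << c *g e >>) -> (forall S T, p S -> p T -> p (S + T)) ->
  forall T, p T.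
Proof.
move=> pU pD T; rewrite (monalgE T); apply: (big_ind p) => [|S S'|e _].
- by rewrite -(monalgU0 (0 : int * nat)); apply: pU.
- exact: pD.
- exact: pU.
Qed.

Lemma termwise_add (c : int * nat -> K) (h : int * nat -> int * nat) :
  {morph (fun P => \sum_(e <- msupp P) << c e * P@_e *g h e >> : laurent K l) :
    S T / S + T}.
Proof.
move=> S T /=.
have sumE (R : laurent K l) (d : {fset int * nat}) : (msupp R `<=` d)%fset ->
    \sum_(e <- msupp R) << c e * R@_e *g h e >> =
    \sum_(e <- d) << c e * R@_e *g h e >> :> laurent K l.
  move=> le_d; apply: big_fset_incl => // e _ /mcoeff_outdom ->.
  by rewrite mulr0 monalgU0.
rewrite (sumE _ _ (msuppD_le S T)) (sumE _ _ (fsubsetUl _ (msupp T))).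
rewrite (sumE _ _ (fsubsetUr (msupp S) _)) -big_split /=.
by apply: eq_bigr => e _; rewrite mcoeffD mulrDr monalgUD.
Qed.

Lemma derxD : {morph @derx K l : S T / S + T}.
Proof. exact: termwise_add. Qed.

Lemma deryD : {morph @dery K l : S T / S + T}.
Proof. exact: termwise_add. Qed.

Lemma termwise_mono (c : int * nat -> K) (h : int * nat -> int * nat) k e :
  \sum_(e' <- msupp (<< k *g e >> : laurent K l))
     << c e' * (<< k *g e >> : laurent K l)@_e' *g h e' >> =
  << c e * k *g h e >> :> laurent K l.
Proof.
rewrite msuppU; have [->|_] := eqVneq k 0; last by rewrite big_seq_fset1 mcoeffUU.
by rewrite big_seq_fset0 mulr0 monalgU0.
Qed.

Lemma derx_mono c e : derx (<< c *g e >> : laurent K l) =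
  << e.1%:~R / l%:R * c *g (e.1 - l%:Z, e.2) >>.
Proof. exact: termwise_mono. Qed.

Lemma dery_mono c e : dery (<< c *g e >> : laurent K l) =
  << e.2%:R * c *g (e.1, e.2.-1) >>.
Proof. exact: termwise_mono. Qed.

Lemma mono_mul c c' e f :
  (<< c *g e >> : laurent K l) * << c' *g f >> = << c * c' *g e + f >>.
Proof. exact: lmulUU. Qed.

Lemma derxM P Q : leibniz_at (@derx K l) P Q.
Proof.
elim/laurent_ind: P => [c [i j]|S T IHS IHT];
  last exact: leibniz_atDl derxD _ _ _ IHS IHT.
elim/laurent_ind: Q => [c' [i' j']|S T IHS IHT];
  last exact: leibniz_atDr derxD _ _ _ IHS IHT.
rewrite /leibniz_at !(mono_mul, derx_mono) /=.
have -> : ((i - l%:Z, j) + (i', j') : int * nat) = (i + i' - l%:Z, (j + j')%N).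
  by congr pair => //=; ring.
have -> : ((i, j) + (i' - l%:Z, j') : int * nat) = (i + i' - l%:Z, (j + j')%N).
  by congr pair => //=; ring.
by rewrite -monalgUD intrD; congr << _ *g _ >>; ring.
Qed.

Lemma deryM P Q : leibniz_at (@dery K l) P Q.
Proof.
elim/laurent_ind: P => [c [i j]|S T IHS IHT];
  last exact: leibniz_atDl deryD _ _ _ IHS IHT.
elim/laurent_ind: Q => [c' [i' j']|S T IHS IHT];
  last exact: leibniz_atDr deryD _ _ _ IHS IHT.
rewrite /leibniz_at !(mono_mul, dery_mono) /=.
have -> : << j%:R * c * c' *g ((i, j.-1) + (i', j') : int * nat) >> =
          << j%:R * c * c' *g (i + i', (j + j').-1%N) >> :> laurent K l.
  by case: j => [|j]; rewrite ?mul0r ?monalgU0.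
have -> : << c * (j'%:R * c') *g ((i, j) + (i', j'.-1) : int * nat) >> =
          << c * (j'%:R * c') *g (i + i', (j + j').-1%N) >> :> laurent K l.
  case: j' => [|j']; rewrite ?mul0r ?mulr0 ?monalgU0 //.
  by congr << _ *g _ >>; congr pair; rewrite /= addnS.
by rewrite -monalgUD natrD; congr << _ *g _ >>; ring.
Qed.

Lemma jacDl T : {morph (@jac K l)^~ T : P Q / P + Q}.
Proof. exact: bracketDl derxD deryD T. Qed.

Lemma jacC P Q : jac P Q = - jac Q P.
Proof. exact: bracketC. Qed.

Lemma jacDr T : {morph @jac K l T : P Q / P + Q}.
Proof. exact: bracketDr derxD deryD T. Qed.

Lemma jacMl P Q T : jac (P * Q) T = jac P T * Q + P * jac Q T.
Proof. exact: (bracketMl derxM deryM). Qed.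

Lemma jacxx P : jac P P = 0.
Proof. exact: bracketxx. Qed.

Lemma jac0l P : jac 0 P = 0.
Proof. by apply: (addrI (jac 0 P)); rewrite -jacDl !addr0. Qed.

Lemma jac0r P : jac P 0 = 0.
Proof. by rewrite jacC jac0l oppr0. Qed.

Lemma jac_scalar c P : jac c%:A P = 0.
Proof.
have -> : c%:A = << c *g 0 >> :> laurent K l.
  apply/malgP => e; rewrite mcoeffZ [X in c * X]mcoeffU [RHS]mcoeffU.
  by rewrite mulrnAr mulr1.
by rewrite /jac derx_mono dery_mono /= !mul0r !monalgU0 !mul0r subrr.
Qed.

Definition mono_cross e f : int := e.1 * f.2%:Z - e.2%:Z * f.1.

Definition jac_exp e f : int * nat := (e.1 + f.1 - l%:Z, (e.2 + f.2).-1%N).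

Lemma jac_mono c c' e f :
  jac (<< c *g e >> : laurent K l) << c' *g f >> =
  << c * c' * ((mono_cross e f)%:~R / l%:R) *g jac_exp e f >>.
Proof.
case: e f => [i j] [i' j']; rewrite /jac /mono_cross /jac_exp.
rewrite !(derx_mono, dery_mono, mono_mul) /=.
have -> : << i%:~R / l%:R * c * (j'%:R * c')
              *g ((i - l%:Z, j) + (i', j'.-1) : int * nat) >> =
          << i%:~R / l%:R * c * (j'%:R * c')
              *g (i + i' - l%:Z, (j + j').-1%N) >> :> laurent K l.
  case: j' => [|j']; rewrite ?mul0r ?mulr0 ?monalgU0 //.
  by congr << _ *g _ >>; congr pair; rewrite /= ?addnS //; ring.
have -> : << j%:R * c * (i'%:~R / l%:R * c')
              *g ((i, j.-1) + (i' - l%:Z, j') : int * nat) >> =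
          << j%:R * c * (i'%:~R / l%:R * c')
              *g (i + i' - l%:Z, (j + j').-1%N) >> :> laurent K l.
  case: j => [|j]; rewrite ?mul0r ?mulr0 ?monalgU0 //.
  by congr << _ *g _ >>; congr pair; rewrite /= ?addSn //; ring.
rewrite -monalgUB; congr << _ *g _ >>.
by rewrite intrB !intrM; ring.
Qed.

Lemma jacE P Q : jac P Q = \sum_(e <- msupp P) \sum_(f <- msupp Q)
  << P@_e * Q@_f * ((mono_cross e f)%:~R / l%:R) *g jac_exp e f >>.
Proof.
rewrite {1}(monalgE P) (big_morph _ (jacDl Q) (jac0l Q)).
apply: eq_bigr => e _; rewrite {1}(monalgE Q).
rewrite (big_morph _ (jacDr _) (jac0r _)).
by apply: eq_bigr => f _; rewrite jac_mono.
Qed.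

Lemma msupp_jac P Q g : g \in msupp (jac P Q) -> exists e f,
  [/\ e \in msupp P, f \in msupp Q, mono_cross e f != 0 & g = jac_exp e f].
Proof.
rewrite -mcoeff_neq0 jacE; set r := msupp P; set r' := msupp Q => coef_neq0.
have [/hasP[e eP /hasP[f fQ /andP[efn0 /eqP gE]]]|/hasPn none] :=
    boolP (has (fun e => has (fun f =>
      (mono_cross e f != 0) && (g == jac_exp e f)) r') r); first by exists e, f.
case/eqP: coef_neq0; rewrite (raddf_sum (mcoeff g)) big_seq big1 //= => e eP.
rewrite (raddf_sum (mcoeff g)) big_seq big1 //= => f fQ.
have /hasPn/(_ f fQ) := none e eP; rewrite mcoeffU [g == _]eq_sym negb_and negbK.
by case/orP => [/eqP ->|/negPf ->]; rewrite ?mulr0n // mul0r mulr0 mul0rn.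
Qed.

Lemma jac_nilpotent_add P S T n :
  iter_jac S P n = 0 -> iter_jac T P n = 0 -> iter_jac (S + T) P n = 0.
Proof.
have -> : iter_jac (S + T) P n = iter_jac S P n + iter_jac T P n.
  by elim: n => //= n ->; apply: jacDl.
by move=> -> ->; rewrite addr0.
Qed.

Lemma iter_jac0 P n : iter_jac 0 P n = 0.
Proof. by elim: n => //= n ->; rewrite jac0l. Qed.

Lemma iter_jacD T P i j : iter_jac T P (i + j) = iter_jac (iter_jac T P j) P i.
Proof. exact: iterD. Qed.

Lemma iter_jacSr T P j : iter_jac T P j.+1 = iter_jac (jac T P) P j.
Proof. exact: iterSr. Qed.

Lemma iter_jac_eq0 T P i j : (i <= j)%N ->
  iter_jac T P i = 0 -> iter_jac T P j = 0.
Proof. by move=> /subnK <- Ti; rewrite iter_jacD Ti iter_jac0. Qed.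

Lemma jac_nilpotent_mul P S T i j :
  iter_jac S P i = 0 -> iter_jac T P j = 0 -> iter_jac (S * T) P (i + j) = 0.
Proof.
have [n] := ubnP (i + j); elim: n S T i j => // n IHn S T [|i] [|j] + Si Tj.
- by move=> _; rewrite [S]Si mul0r iter_jac0.
- by move=> _; rewrite [S]Si mul0r iter_jac0.
- by move=> _; rewrite [T]Tj mulr0 iter_jac0.
rewrite ltnS addSn => le_n; rewrite iter_jacSr jacMl.
have Si' := etrans (esym (iter_jacSr S P i)) Si.
have Tj' := etrans (esym (iter_jacSr T P j)) Tj.
apply: jac_nilpotent_add; first exact: IHn (jac S P) T i j.+1 le_n Si' Tj.
by rewrite -addSnnS in le_n *; exact: IHn S (jac T P) i.+1 j le_n Si Tj'.
Qed.

Lemma subalg_jac_nilpotent P Q T c : jac Q P = c%:A -> subalg_gen P Q T ->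
  exists n, iter_jac T P n = 0.
Proof.
move=> jacQP; elim=> [c'|||S T' _ [i Si] _ [j Tj]|S T' _ [i Si] _ [j Tj]].
- by exists 1%N; apply: jac_scalar.
- by exists 1%N; apply: jacxx.
- by exists 2%N; rewrite /= jacQP jac_scalar.
- exists (maxn i j); apply: jac_nilpotent_add.
    exact: iter_jac_eq0 (leq_maxl _ _) Si.
  exact: iter_jac_eq0 (leq_maxr _ _) Tj.
- by exists (i + j)%N; apply: jac_nilpotent_mul.
Qed.

End JacobianAlgebra.

Lemma exists_max_seq (T : eqType) (f : T -> rat) (r : seq T) x0 : x0 \in r ->
  exists2 x, x \in r & forall y, y \in r -> f y <= f x.
Proof.
elim: r x0 => // x r IHr _ _; case: r IHr => [|x1 r] IHr.
  by exists x => [|y]; rewrite ?mem_head // inE => /eqP ->.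
have [x2 x2r max2] := IHr x1 (mem_head _ _).
have [le12|/ltW le21] := leP (f x) (f x2).
  exists x2 => [|y]; first by rewrite inE x2r orbT.
  by rewrite inE => /predU1P[-> //|/max2].
exists x => [|y]; first exact: mem_head.
by rewrite inE => /predU1P[-> //|/max2 le_y]; apply: le_trans le_y le21.
Qed.

Section LeadingForms.

Variables (K : fieldType) (l : nat).
Implicit Types (P T : laurent K l) (d u v : int * int) (e f g : int * nat).

Lemma wtZ d (k : rat) (a : point) : wt d (k *: a) = k * wt d a.
Proof. by rewrite /wt /= /GRing.scale /=; ring. Qed.

Lemma wt_comb (p q : int) u v (a : point) :
  wt (p * u.1 + q * v.1, p * u.2 + q * v.2) a =
  p%:~R * wt u a + q%:~R * wt v a.
Proof. by rewrite /wt /= !intrD !intrM; ring. Qed.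

Definition is_top d T e :=
  e \in msupp T /\ forall f, f \in msupp T -> wt d (pt l f) <= wt d (pt l e).

Lemma val_dir_top d T e : is_top d T e -> val_dir d T = (wt d (pt l e))%:E.
Proof.
move=> [eT max_e]; apply/eqP; rewrite /val_dir eq_le; apply/andP; split.
  rewrite big_seq; apply: bigmax_le => [|a /imfsetP[/= f fT ->]].
    by rewrite leNye.
  by rewrite lee_fin max_e.
apply: (@le_bigmax_seq _ _ _ _ -oo%E (pt l e) xpredT
  (fun a => (wt d a)%:E)) => //.
by apply: in_imfset.
Qed.

Lemma val_dir0 d : val_dir d (0 : laurent K l) = -oo%E.
Proof. by rewrite /val_dir /Supp msupp0 imfset0 big_seq_fset0. Qed.

Lemma lead_dir0 d : lead_dir d (0 : laurent K l) = 0.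
Proof. by rewrite /lead_dir big_mkcond msupp0 big_seq_fset0. Qed.

(* [e] is the exponent that the leading forms of [T] single out along
   [d + epsilon d'] for all small [epsilon > 0]. *)
Definition is_top2 d d' T e :=
  e \in msupp T /\ forall f, f \in msupp T -> wt d (pt l f) < wt d (pt l e) \/
    wt d (pt l f) = wt d (pt l e) /\ wt d' (pt l f) <= wt d' (pt l e).

Lemma is_top2_top d d' T e : is_top2 d d' T e -> is_top d T e.
Proof.
by move=> [eT top_e]; split=> // f /top_e [/ltW //|[-> _]].
Qed.

Lemma msupp_neq0 T : T != 0 -> exists e, e \in msupp T.
Proof.
have [/eqP T0|/fset0Pn[e eT] _] := boolP (msupp T == fset0); last by exists e.
by case/eqP; apply/malgP => e; rewrite mcoeff0 mcoeff_outdom // T0.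
Qed.

Lemma exists_top2 d d' T : T != 0 -> exists e, is_top2 d d' T e.
Proof.
case/msupp_neq0 => e0 e0T.
have [e eT max_e] := exists_max_seq (fun e => wt d (pt l e)) e0T.
pose r := [seq f <- msupp T | wt d (pt l f) == wt d (pt l e)].
have er : e \in r by rewrite mem_filter eqxx.
have [f] := exists_max_seq (fun e => wt d' (pt l e)) er.
rewrite mem_filter => /andP[/eqP wf fT] max_f; exists f; split=> // g gT.
rewrite wf; have := max_e _ gT; rewrite le_eqVlt => /predU1P[wg|]; last by left.
by right; split=> //; apply: max_f; rewrite mem_filter wg eqxx.
Qed.

Lemma msupp_lead d T e f : is_top d T e ->
  (f \in msupp (lead_dir d T)) =
  (f \in msupp T) && (wt d (pt l f) == wt d (pt l e)).
Proof.
move=> top_e; rewrite -!mcoeff_neq0 mcoeff_lead (val_dir_top top_e) eqe.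
by case: (wt d _ == _); rewrite ?eqxx ?andbT ?andbF.
Qed.

Lemma is_top_lead u v T e : is_top2 u v T e -> is_top v (lead_dir u T) e.
Proof.
move=> top2_e; have top_e := is_top2_top top2_e; have [eT max_e] := top2_e.
split=> [|f]; rewrite (msupp_lead _ top_e) ?eT ?eqxx //.
by case/andP=> /max_e [lt_f /eqP wf|[_ ->] //]; rewrite wf ltxx in lt_f.
Qed.

Hypothesis l_gt0 : (0 < l)%N.

Let l_neq0 : l%:R != 0 :> rat.
Proof. by rewrite pnatr_eq0 -lt0n. Qed.

Lemma cross_pt e f : cross (pt l e) (pt l f) = (mono_cross e f)%:~R / l%:R.
Proof. by rewrite /cross /mono_cross /= intrB !intrM !pmulrn; field. Qed.

Lemma pt_inj : injective (pt l).
Proof.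
move=> [i j] [i' j'] [] /(mulIf (invr_neq0 l_neq0)) /intr_inj -> /eqP.
by rewrite eqr_nat => /eqP ->.
Qed.

Lemma wt_jac_exp d e f : mono_cross e f != 0 ->
  wt d (pt l (jac_exp l e f)) =
  wt d (pt l e) + wt d (pt l f) - (d.1 + d.2)%:~R.
Proof.
move=> ef_neq0; have gt0 : (0 < e.2 + f.2)%N.
  rewrite lt0n; apply: contraNneq ef_neq0 => /eqP.
  by rewrite addn_eq0 /mono_cross => /andP[/eqP -> /eqP ->]; rewrite mulr0 mul0r.
rewrite /wt /pt /jac_exp /= -subn1 natrB // !(intrB, intrD) natrD -pmulrn.
by field.
Qed.

Lemma jac_wt_le d T P e f g : is_top d T e -> is_top d P f ->
  g \in msupp (jac T P) ->
  wt d (pt l g) <= wt d (pt l e) + wt d (pt l f) - (d.1 + d.2)%:~R.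
Proof.
move=> [_ max_e] [_ max_f] /msupp_jac[e' [f' [eT fP ef_neq0 ->]]].
by rewrite wt_jac_exp // lerB // lerD ?max_e ?max_f.
Qed.

Lemma jac_lead_coef d T P e f g : is_top d T e -> is_top d P f ->
  wt d (pt l g) = wt d (pt l e) + wt d (pt l f) - (d.1 + d.2)%:~R ->
  (jac T P)@_g = (jac (lead_dir d T) (lead_dir d P))@_g.
Proof.
move=> top_e top_f wg.
have low (S : laurent K l) s : is_top d S s -> forall s',
    s' \in msupp (S - lead_dir d S) -> wt d (pt l s') < wt d (pt l s).
  move=> top_s s' s'S; have [_ max_s] := top_s.
  have sS : s' \in msupp S.
    move: s'S; rewrite -!mcoeff_neq0 mcoeffB mcoeff_lead.
    by apply: contra_neq => ->; rewrite if_same subrr.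
  rewrite lt_neqAle max_s // andbT; apply: contraTneq s'S => ws.
  rewrite -mcoeff_eq0 mcoeffB mcoeff_lead (val_dir_top top_s) ws eqxx.
  by rewrite subrr.
have zero (S R : laurent K l) : (forall e' f', e' \in msupp S -> f' \in msupp R ->
    wt d (pt l e') + wt d (pt l f') < wt d (pt l e) + wt d (pt l f)) ->
    (jac S R)@_g = 0.
  move=> lt_w; apply/eqP; rewrite mcoeff_eq0; apply/negP.
  case/msupp_jac => e' [f' [e'S f'R ef_neq0 gE]].
  have := lt_w _ _ e'S f'R; have := wg; rewrite gE wt_jac_exp // => /addIr ->.
  by rewrite ltxx.
pose LT := lead_dir d T; pose LP := lead_dir d P.
have jacTP : jac T P = jac LT LP + jac LT (P - LP) + jac (T - LT) P.
  rewrite -(jacDr LT LP) (addrC LP) subrK -(jacDl P LT) (addrC LT) subrK.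
  by [].
have coefD (A B C D : laurent K l) : A = B + C + D -> C@_g = 0 -> D@_g = 0 ->
    A@_g = B@_g.
  by move=> -> C0 D0; rewrite mcoeffD D0 addr0 mcoeffD C0 addr0.
apply: (coefD _ _ _ _ jacTP); apply: zero => e' f'.
  rewrite (msupp_lead _ top_e) => /andP[_ /eqP ->] /(low _ _ top_f).
  by rewrite ltrD2l.
by move=> /(low _ _ top_e) lt_e /(proj2 top_f) le_f; rewrite ltr_leD.
Qed.

Lemma jac_lead_top d T P e f : is_top d T e -> is_top d P f ->
  jac (lead_dir d T) (lead_dir d P) != 0 ->
  exists2 g, is_top d (jac T P) g &
    wt d (pt l g) = wt d (pt l e) + wt d (pt l f) - (d.1 + d.2)%:~R.
Proof.
move=> top_e top_f /msupp_neq0[g gL].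
have wg : wt d (pt l g) = wt d (pt l e) + wt d (pt l f) - (d.1 + d.2)%:~R.
  have [e' [f' [+ + ef_neq0 ->]]] := msupp_jac gL.
  rewrite (msupp_lead _ top_e) (msupp_lead _ top_f) wt_jac_exp //.
  by case/andP=> _ /eqP -> /andP[_ /eqP ->].
exists g; last exact: wg.
split=> [|g' /(jac_wt_le top_e top_f) le_g']; last by rewrite wg.
have coefE := jac_lead_coef top_e top_f wg.
have coef_neq0 : (jac (lead_dir d T) (lead_dir d P))@_g != 0.
  by rewrite mcoeff_neq0.
have := contra_neq (etrans (esym coefE)) coef_neq0.
by rewrite mcoeff_neq0.
Qed.

Lemma wt_inj u v (a b : point) : cross (vec u) (vec v) != 0 ->
  wt u a = wt u b -> wt v a = wt v b -> a = b.
Proof.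
case: a b => [a1 a2] [b1 b2]; rewrite /cross /wt /= => uv wu wv.
congr pair; apply: (mulfI uv).
  transitivity (v.2%:~R * (u.1%:~R * a1 + u.2%:~R * a2)
                - u.2%:~R * (v.1%:~R * a1 + v.2%:~R * a2)); first by ring.
  by rewrite wu wv; ring.
transitivity (u.1%:~R * (v.1%:~R * a1 + v.2%:~R * a2)
              - v.1%:~R * (u.1%:~R * a1 + u.2%:~R * a2)); first by ring.
by rewrite wu wv; ring.
Qed.

Lemma lead_lead_mono u v T e : cross (vec u) (vec v) != 0 ->
  is_top2 u v T e -> lead_dir v (lead_dir u T) = << T@_e *g e >>.
Proof.
move=> uv top2_e; have top_e := is_top2_top top2_e.
have top_v := is_top_lead top2_e.
apply/malgP => f; rewrite mcoeffU; have [<-|ef] := eqVneq e f.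
  by rewrite !mcoeff_lead (val_dir_top top_v) (val_dir_top top_e) !eqxx.
apply/eqP; rewrite mcoeff_eq0 (msupp_lead _ top_v) (msupp_lead _ top_e).
apply: contra ef => /andP[/andP[_ /eqP wu] /eqP wv].
by rewrite (pt_inj (wt_inj uv wu wv)).
Qed.

Hypothesis charK : [pchar K] =i pred0.

Lemma jac_lead_eq0 u v T P e f : cross (vec u) (vec v) != 0 ->
  is_top2 u v T e -> is_top2 u v P f ->
  jac (lead_dir u T) (lead_dir u P) = 0 -> cross (pt l e) (pt l f) = 0.
Proof.
move=> uv top2_e top2_f jac0; rewrite cross_pt.
have [->|ef_neq0] := eqVneq (mono_cross e f) 0; first by rewrite mul0r.
have := jac_lead_coef (is_top_lead top2_e) (is_top_lead top2_f)
  (wt_jac_exp v ef_neq0).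
rewrite (lead_lead_mono uv top2_e) (lead_lead_mono uv top2_f).
rewrite jac0 mcoeff0 jac_mono mcoeffUU => /esym/eqP.
have /pcharf0P nat0 := charK.
have int0 (z : int) : (z%:~R == 0 :> K) = (z == 0).
  by case: z => k; rewrite ?NegzE ?mulrNz ?oppr_eq0 -[_%:~R]/(_%:R) nat0.
rewrite !mulf_eq0 invr_eq0 nat0 int0 (negPf ef_neq0) -[l == 0]negbK -lt0n l_gt0.
by rewrite !mcoeff_eq0 (proj1 top2_e) (proj1 top2_f).
Qed.

End LeadingForms.

Lemma sub_count_lt (T : eqType) (a1 a2 : pred T) (s : seq T) x :
  subpred a1 a2 -> x \in s -> a2 x -> ~~ a1 x -> (count a1 s < count a2 s)%N.
Proof.
move=> a12 + a2x a1x; elim: s => //= y s IHs.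
rewrite inE => /predU1P[<-|/IHs lt_s].
  by rewrite a2x (negPf a1x) ltnS sub_count.
rewrite -addnS leq_add //; by case: (boolP (a1 y)) => // /a12 ->.
Qed.

Lemma cross_eq0_scale (u : int * int) (k : rat) (a b : point) :
  wt u b != 0 -> cross a b = 0 -> wt u a = k * wt u b -> a = k *: b.
Proof.
case: a b => [a1 a2] [b1 b2]; rewrite /cross /wt /= => ub_neq0 /eqP.
rewrite subr_eq0 => /eqP ab ua; congr pair; apply: (mulfI ub_neq0).
  transitivity (a1 * b1 * u.1%:~R + u.2%:~R * (a1 * b2)); first by ring.
  rewrite ab; transitivity (b1 * (u.1%:~R * a1 + u.2%:~R * a2)); first by ring.
  by rewrite ua /GRing.scale /=; ring.
transitivity (a2 * b2 * u.2%:~R + u.1%:~R * (a2 * b1)); first by ring.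
rewrite -ab; transitivity (b2 * (u.1%:~R * a1 + u.2%:~R * a2)); first by ring.
by rewrite ua /GRing.scale /=; ring.
Qed.

Definition comb (p q : int) (u v : int * int) : int * int :=
  (p * u.1 + q * v.1, p * u.2 + q * v.2).

Section Walk.

Variables (K : fieldType) (l : nat) (P : laurent K l) (T : nat -> laurent K l).
Hypotheses (charK : [pchar K] =i pred0) (l_gt0 : (0 < l)%N).
Hypotheses (P_neq0 : P != 0) (TS : forall j, T j.+1 = jac (T j) P).
Variable r : seq (int * nat).
Hypotheses (supp_P : {subset msupp P <= r}).
Hypotheses (supp_T : forall j, {subset msupp (T j) <= r}).
Variables (lam : nat -> rat) (kappa : rat).
Hypothesis lamS : forall j, T j.+1 != 0 -> lam j.+1 <= lam j + 1 - kappa.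

Local Notation w d e := (wt d (pt l e)).

Definition slow d := forall f, is_top d P f ->
  0 < w d f /\ (d.1 + d.2)%:~R < kappa * w d f.

Definition proportional d := forall f, is_top d P f ->
  forall j e, is_top d (T j) e -> w d e = lam j * w d f.

Definition commuting d := forall j, jac (lead_dir d (T j)) (lead_dir d P) = 0.

Definition aligned u v := exists2 f, is_top2 u v P f &
  forall j, T j != 0 -> exists2 e, is_top2 u v (T j) e & pt l e = lam j *: pt l f.

Lemma is_top_wt_eq d (S : laurent K l) e f :
  is_top d S e -> is_top d S f -> w d e = w d f.
Proof. by move=> [eS max_e] [fS max_f]; apply: le_anti; rewrite max_f ?max_e. Qed.

(* A nonzero bracket would make [lam j.+1] equal to
   [lam j + 1 - (d.1 + d.2) / w d f], which is too large. *)
Lemma proportional_commuting d : slow d -> proportional d -> commuting d.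
Proof.
move=> slow_d prop_d j; apply/eqP; apply: contraT => jac_neq0.
have [f0 /is_top2_top top_f] := exists_top2 d d P_neq0.
have [Tj0|Tj_neq0] := eqVneq (T j) 0.
  by case/negP: jac_neq0; apply/eqP; rewrite Tj0 lead_dir0 jac0l.
have [e /is_top2_top top_e] := exists_top2 d d Tj_neq0.
have [g + wg] := jac_lead_top l_gt0 top_e top_f jac_neq0; rewrite -TS => top_g.
have TS_neq0 : T j.+1 != 0.
  by apply: contraTneq (proj1 top_g) => ->; rewrite msupp0 in_fset0.
have [wf_gt0 lt_k] := slow_d _ top_f.
have := lamS TS_neq0; move: wg.
rewrite (prop_d _ top_f _ _ top_e) (prop_d _ top_f _ _ top_g) => wg le_lam.
have : lam j.+1 * w d f0 <= (lam j + 1 - kappa) * w d f0 by rewrite ler_pM2r.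
by rewrite wg; lra.
Qed.

Lemma commuting_aligned u v : cross (vec u) (vec v) != 0 -> slow u ->
  proportional u -> commuting u -> aligned u v.
Proof.
move=> uv slow_u prop_u comm_u; have [f top2_f] := exists_top2 u v P_neq0.
exists f => // j Tj_neq0; have [e top2_e] := exists_top2 u v Tj_neq0; exists e => //.
have top_f := is_top2_top top2_f; have [wf_gt0 _] := slow_u _ top_f.
apply: (@cross_eq0_scale u); first by rewrite gt_eqF.
  exact: (jac_lead_eq0 l_gt0 charK uv top2_e top2_f (comm_u j)).
exact: (prop_u _ top_f _ _ (is_top2_top top2_e)).
Qed.

Definition swaps u v ef := (w u ef.2 < w u ef.1) && (w v ef.1 < w v ef.2).

Definition swap_count u v := count (swaps u v) [seq (e, f) | e <- r, f <- r].

Lemma no_swap_proportional u v :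
  (forall e f, e \in r -> f \in r -> ~~ swaps u v (e, f)) ->
  aligned u v -> proportional v.
Proof.
move=> no_swap [f top2_f algn] f' top_f' j e' top_e'.
have top2_v (S : laurent K l) e : {subset msupp S <= r} ->
    is_top2 u v S e -> is_top v S e.
  move=> sub_r [eS top_e]; split=> // g gS; have [lt_g|[_ //]] := top_e _ gS.
  by have := no_swap _ _ (sub_r _ eS) (sub_r _ gS); rewrite /swaps /= lt_g -leNgt.
have Tj_neq0 : T j != 0.
  by apply: contraTneq (proj1 top_e') => ->; rewrite msupp0 in_fset0.
have [e top2_e eE] := algn _ Tj_neq0.
rewrite (is_top_wt_eq top_e' (top2_v _ _ (@supp_T j) top2_e)).
by rewrite (is_top_wt_eq top_f' (top2_v _ _ supp_P top2_f)) eE wtZ.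
Qed.

Lemma aligned_comb u v p q : 0 < q -> aligned u v -> aligned u (comb p q u v).
Proof.
move=> q_gt0 [f top2_f algn].
have top2_comb (S : laurent K l) e :
    is_top2 u v S e -> is_top2 u (comb p q u v) S e.
  move=> [eS top_e]; split=> // g /top_e [|[wu wv]]; [by left | right].
  by rewrite !wt_comb wu lerD2l ler_pM2l ?ltr0z.
exists f => [|j /algn[e top2_e eE]]; first exact: top2_comb.
by exists e => //; apply: top2_comb.
Qed.

Definition iwt (d : int * int) (e : int * nat) : int :=
  d.1 * e.1 + d.2 * (l * e.2)%N%:Z.

Lemma wtE d e : w d e = (iwt d e)%:~R / l%:R.
Proof.
have l_neq0 : l%:R != 0 :> rat by rewrite pnatr_eq0 -lt0n.
by rewrite /iwt /wt /= intrD !intrM PoszM intrM -!pmulrn; field.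
Qed.

Lemma wt_lt d e f : (w d e < w d f) = (iwt d e < iwt d f).
Proof. by rewrite !wtE ltr_pM2r ?ltr_int // invr_gt0 ltr0n. Qed.

(* When two exponents swap between [u] and [v], stop at the intermediate
   direction where they have the same weight. *)
Lemma walk u v : cross (vec u) (vec v) != 0 ->
  (forall p q : int, 0 <= p -> 0 < q -> slow (comb p q u v)) ->
  aligned u v -> proportional v.
Proof.
have [n] := ubnP (swap_count u v).
elim: n => // n IHn in u v * => lt_n uv slow_uv algn.
have [/hasP[[e f]]|/hasPn none] :=
    boolP (has (swaps u v) [seq (e, f) | e <- r, f <- r]); last first.
  apply: no_swap_proportional algn => e f er fr.
  by apply: none; apply: allpairs_f.
move=> ef_r swap_ef; have /andP[/= wu wv] := swap_ef.
move: (wu) (wv); rewrite !wt_lt -(subr_gt0 (iwt u f)) -(subr_gt0 (iwt v e)).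
set q := iwt u e - iwt u f; set p := iwt v f - iwt v e => q_gt0 p_gt0.
have ef_bal : p%:~R * (w u e - w u f) + q%:~R * (w v e - w v f) = 0.
  by rewrite !wtE /p /q !intrB; ring.
clearbody p q.
have [p_gt0' q_gt0'] : 0 < p%:~R :> rat /\ 0 < q%:~R :> rat.
  by rewrite !ltr0z.
pose x := comb p q u v.
have xE g : w x g = p%:~R * w u g + q%:~R * w v g by apply: wt_comb.
have x_ef : w x e = w x f.
  by apply/eqP; rewrite -subr_eq0 -ef_bal !xE; apply/eqP; ring.
have slow_x : slow x by apply: slow_uv; rewrite // ltW.
have ux : cross (vec u) (vec x) = q%:~R * cross (vec u) (vec v).
  by rewrite /cross /vec /x /comb /= !intrD !intrM; ring.
have xv : cross (vec x) (vec v) = p%:~R * cross (vec u) (vec v).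
  by rewrite /cross /vec /x /comb /= !intrD !intrM; ring.
have prop_x : proportional x.
  apply: (IHn u x); last exact: aligned_comb.
  - apply: leq_trans (_ : swap_count u v <= n)%N; last by rewrite -ltnS.
    apply: (sub_count_lt _ ef_r swap_ef) => [[e' f']|].
      rewrite /swaps !xE /= => /andP[lt_u lt_x]; rewrite lt_u /=; nra.
    by rewrite /swaps /= x_ef ltxx andbF.
  - by rewrite ux mulf_neq0 // gt_eqF.
  move=> p' q' p'_ge0 q'_gt0.
  have -> : comb p' q' u x = comb (p' + q' * p) (q' * q) u v.
    by rewrite /comb /x /=; congr pair; ring.
  by apply: slow_uv; rewrite ?mulr_gt0 // addr_ge0 // mulr_ge0 // ltW.
have xv_neq0 : cross (vec x) (vec v) != 0 by rewrite xv mulf_neq0 // gt_eqF.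
have comm_x := proportional_commuting slow_x prop_x.
apply: (IHn x v _ xv_neq0); last exact: commuting_aligned.
- apply: leq_trans (_ : swap_count u v <= n)%N; last by rewrite -ltnS.
  apply: (sub_count_lt _ ef_r swap_ef) => [[e' f']|].
    rewrite /swaps !xE /= => /andP[lt_x lt_v]; rewrite lt_v andbT; nra.
  by rewrite /swaps /= x_ef ltxx.
move=> p' q' p'_ge0 q'_gt0.
have -> : comb p' q' x v = comb (p' * p) (p' * q + q') u v.
  by rewrite /comb /x /=; congr pair; ring.
by apply: slow_uv; rewrite ?mulr_ge0 ?(ltW p_gt0) // ltr_wpDl // mulr_ge0 // ltW.
Qed.

End Walk.

Section Angles.

Implicit Types (B C D d : int * int).

Definition icross B C : int := B.1 * C.2 - B.2 * C.1.

Lemma cross_vec B C : cross (vec B) (vec C) = (icross B C)%:~R.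
Proof. by rewrite /cross /icross /= intrB !intrM. Qed.

Definition rightward B : bool := (0 < B.1) || (B.1 == 0) && (B.2 < 0).

Lemma angle_leE B C : angle_le (0, -1) B C =
  if rightward B then rightward C ==> (0 <= icross B C)
  else ~~ rightward C && (0 <= icross B C).
Proof.
have rightE D : angle_lt_pi (0, -1) D = rightward D.
  rewrite /angle_lt_pi cross_vec /icross /dot /= mulN1r mul0r mul0r !add0r opprK.
  by rewrite mulN1r oppr_gt0 ltr0z ltrz0 intr_eq0.
by rewrite /angle_le !rightE cross_vec ler0z.
Qed.

Lemma dir_neq0 d : is_dir d -> d.1 != 0 \/ d.2 != 0.
Proof.
case: d => x y; rewrite /is_dir /=; have [->|] := eqVneq x 0; last by left.
by have [->|] := eqVneq y 0; last by right.
Qed.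

Lemma angle_le_trans B C D : is_dir B -> is_dir C ->
  angle_le (0, -1) B C -> angle_le (0, -1) C D -> angle_le (0, -1) B D.
Proof.
move=> /dir_neq0 B0 /dir_neq0 C0; rewrite !angle_leE /rightward /icross.
case: B B0 => x1 x2; case: C C0 => y1 y2; case: D => z1 z2 /= C0 B0.
have key : (x1 * z2 - x2 * z1) * y1 =
    (x1 * y2 - x2 * y1) * z1 + (y1 * z2 - y2 * z1) * x1 by ring.
case: (boolP (_ || _)) => xr; case: (boolP ((0 < y1) || _)) => yr;
  case: (boolP ((0 < z1) || _)) => zr //= xy yz.
- have [y1_gt0|y1_0] : 0 < y1 \/ y1 = 0 by lia.
    rewrite -(pmulr_lge0 _ y1_gt0) key addr_ge0 // mulr_ge0 //; lia.
  have x1_0 : x1 = 0 by subst; nia.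
  subst; nia.
- have [y1_lt0|y1_0] : y1 < 0 \/ y1 = 0 by lia.
    rewrite -(nmulr_lle0 _ y1_lt0) key -[0]addr0 lerD // mulr_ge0_le0 //; lia.
  have x1_0 : x1 = 0 by subst; nia.
  subst; nia.
Qed.

Lemma dir_cross_eq0 B C : is_dir B -> is_dir C -> icross B C = 0 ->
  rightward B = rightward C -> B = C.
Proof.
case: B C => [x1 x2] [y1 y2]; rewrite /is_dir /coprimez /icross /= => Bd Cd xy.
have [u [v uv]] := Bezoutz x1 x2; have [u' [v' uv']] := Bezoutz y1 y2.
move: uv uv'; rewrite (eqP Bd) (eqP Cd) => uv uv'.
pose s := u * y1 + v * y2.
have E1 : y1 = s * x1.
  apply/eqP; rewrite -subr_eq0; apply/eqP.
  transitivity (y1 * (1 - (u * x1 + v * x2)) - v * (x1 * y2 - x2 * y1)).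
    by rewrite /s; ring.
  by rewrite uv xy; ring.
have E2 : y2 = s * x2.
  apply/eqP; rewrite -subr_eq0; apply/eqP.
  transitivity (y2 * (1 - (u * x1 + v * x2)) + u * (x1 * y2 - x2 * y1)).
    by rewrite /s; ring.
  by rewrite uv xy; ring.
clearbody s.
have : (s %| 1)%Z.
  apply/dvdzP; exists (u' * x1 + v' * x2); apply: etrans (esym uv') _.
  by rewrite E1 E2; ring.
rewrite dvdz1 => /eqP s1; have {s1} [s1|s1] : s = 1 \/ s = -1 by lia.
  by rewrite E1 E2 s1 !mul1r.
rewrite /rightward E1 E2 s1 /= !mulN1r.
have := @dir_neq0 (x1, x2) Bd => /=; lia.
Qed.

Lemma exists_dir D : D.1 != 0 \/ D.2 != 0 ->
  exists g d, [/\ 0 < g, is_dir d & D = (g * d.1, g * d.2)].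
Proof.
case: D => x y /= xy; pose g := gcdz x y.
have g_neq0 : g != 0 by rewrite gcdz_eq0; case: xy => /negPf ->; rewrite ?andbF.
have g_gt0 : 0 < g by rewrite lt_neqAle eq_sym g_neq0.
have xE : g * (x %/ g)%Z = x by rewrite mulrC divzK // dvdz_gcdl.
have yE : g * (y %/ g)%Z = y by rewrite mulrC divzK // dvdz_gcdr.
exists g, ((x %/ g)%Z, (y %/ g)%Z); rewrite xE yE; split=> //.
rewrite /is_dir /coprimez; apply/eqP/(mulfI g_neq0).
by rewrite mulr1 -{1}[g]gtz0_abs // mulz_gcdr xE yE.
Qed.

Lemma angle_le_scale (g : int) B C : 0 < g ->
  angle_le (0, -1) (g * B.1, g * B.2) C = angle_le (0, -1) B C /\
  angle_le (0, -1) C (g * B.1, g * B.2) = angle_le (0, -1) C B.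
Proof.
move=> g_gt0; have right_g : rightward (g * B.1, g * B.2) = rightward B.
  by rewrite /rightward /= pmulr_rgt0 // pmulr_rlt0 // mulf_eq0 gt_eqF.
rewrite !angle_leE right_g /icross /= !(mulrCA C.1) !(mulrCA C.2) -!mulrA -!mulrBr.
by rewrite !pmulr_rge0.
Qed.

Lemma rightward_comb (p q : int) B C : 0 <= p -> 0 < q ->
  rightward B -> rightward C -> rightward (comb p q B C).
Proof.
case: B C => [x1 x2] [y1 y2]; rewrite /rightward /comb /= => p_ge0 q_gt0.
case/orP=> [x1_gt0|/andP[/eqP -> x2_lt0]] /orP[y1_gt0|/andP[/eqP -> y2_lt0]];
  rewrite ?(mulr0, add0r, addr0).
- by rewrite ltr_wpDl ?mulr_ge0 ?mulr_gt0 // ltW.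
- have [->|p_neq0] := eqVneq p 0.
    by rewrite !mul0r !add0r pmulr_rlt0 // y2_lt0 eqxx orbT.
  by rewrite mulr_gt0 // lt_neqAle eq_sym p_neq0.
- by rewrite mulr_gt0.
by rewrite eqxx /= ltr_wnDl ?mulr_ge0_le0 ?pmulr_rlt0 // ltW.
Qed.

Lemma rightward_opp B : B.1 != 0 \/ B.2 != 0 ->
  rightward (- B.1, - B.2) = ~~ rightward B.
Proof. by case: B => x y; rewrite /rightward /=; lia. Qed.

Lemma angle_le_cone (p q : int) d0 d : 0 <= p -> 0 < q ->
  angle_le (0, -1) d d0 -> 0 < icross d d0 ->
  [/\ angle_le (0, -1) d (comb p q d0 d), angle_le (0, -1) (comb p q d0 d) d0 &
      0 < icross (comb p q d0 d) d0].
Proof.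
move=> p_ge0 q_gt0; set D := comb p q d0 d => le_d cr.
have crD : icross D d0 = q * icross d d0 by rewrite /icross /D /comb /=; ring.
have crd : icross d D = p * icross d d0 by rewrite /icross /D /comb /=; ring.
move: le_d; rewrite !angle_leE crD crd pmulr_rgt0 // (pmulr_rge0 _ q_gt0).
rewrite mulr_ge0 ?(ltW cr) // !implybT !andbT.
have neq0 : [/\ d.1 != 0 \/ d.2 != 0, d0.1 != 0 \/ d0.2 != 0 &
              D.1 != 0 \/ D.2 != 0].
  have cr0 B C : 0 < icross B C ->
      (B.1 != 0 \/ B.2 != 0) /\ (C.1 != 0 \/ C.2 != 0).
    rewrite /icross; case: B C => [x1 x2] [y1 y2] /= cr_gt0; split.
      have [x1_0|] := eqVneq x1 0; last by left.
      by right; apply: contraTneq cr_gt0 => ->; rewrite x1_0 !mul0r ltxx.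
    have [y1_0|] := eqVneq y1 0; last by left.
    by right; apply: contraTneq cr_gt0 => ->; rewrite y1_0 !mulr0 ltxx.
  have [d_neq0 d0_neq0] := cr0 _ _ cr; split=> //.
  by have [] := cr0 D d0; rewrite // crD mulr_gt0.
have [d_neq0 d0_neq0 D_neq0] := neq0.
case: (boolP (rightward d)) => rd; case: (boolP (rightward d0)) => rd0 //=.
- by rewrite rightward_comb.
- by case: ifP.
rewrite -(negbK (rightward D)) -rightward_opp //.
have -> : (- D.1, - D.2) = comb p q (- d0.1, - d0.2) (- d.1, - d.2).
  by rewrite /D /comb /=; congr pair; ring.
by rewrite rightward_comb // rightward_opp.
Qed.

(* The arc from [d] to [d0] may exceed a half-turn; it is then cut at (1, 0). *)
Lemma angle_le_cut (p q : int) d0 d : 0 <= p -> 0 < q ->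
  rightward d -> ~~ rightward d0 -> d.2 < 0 -> 0 < d0.2 ->
  [/\ angle_le (0, -1) d (comb p q d0 (1, 0)),
      angle_le (0, -1) (comb p q d0 (1, 0)) d0,
      0 < icross (comb p q d0 (1, 0)) d0,
      angle_le (0, -1) d (comb p q (1, 0) d) &
      angle_le (0, -1) (comb p q (1, 0) d) d0].
Proof.
move=> p_ge0 q_gt0 rd rd0 d2_lt0 d02_gt0.
have d1_ge0 : 0 <= d.1 by move: rd; rewrite /rightward; lia.
have crE : icross (comb p q d0 (1, 0)) d0 = q * d0.2.
  by rewrite /icross /comb /=; ring.
have crE' : icross d (comb p q (1, 0) d) = - (p * d.2).
  by rewrite /icross /comb /=; ring.
have rD : rightward (comb p q (1, 0) d).
  have D1_ge0 : 0 <= p * 1 + q * d.1 by rewrite addr_ge0 ?mulr_ge0 // ltW.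
  have D2_lt0 : p * 0 + q * d.2 < 0 by rewrite mulr0 add0r pmulr_rlt0.
  by rewrite /rightward /comb /= D2_lt0 andbT orbC eq_sym -le_eqVlt.
rewrite !angle_leE rd (negPf rd0) crE crE' rD /=; split=> //.
- apply/implyP => rD'; rewrite /icross subr_ge0.
  apply: le_trans (_ : 0 <= _).
    rewrite nmulr_rle0 //; move: rD'; rewrite /rightward; lia.
  by rewrite mulr_ge0 //= mulr0 addr0 mulr_ge0 // ltW.
- by case: ifP => //= _; rewrite mulr_ge0 ?ltW.
- by rewrite mulr_gt0.
by rewrite oppr_ge0 mulr_ge0_le0 // ltW.
Qed.

Lemma upward d0 : is_dir d0 -> 0 <= d0.1 + d0.2 -> ~~ rightward d0 ->
  d0.1 <= 0 /\ 0 < d0.2.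
Proof. by move=> /dir_neq0; rewrite /rightward; lia. Qed.

Lemma icross_upward d d0 : rightward d -> 0 <= d.2 -> d0.1 <= 0 -> 0 < d0.2 ->
  0 < icross d d0.
Proof.
rewrite /rightward /icross => rd d2_ge0 d01_le0 d02_gt0.
have d1_gt0 : 0 < d.1 by lia.
by rewrite subr_gt0 (le_lt_trans (_ : _ <= 0)) ?mulr_ge0_le0 ?mulr_gt0.
Qed.

Lemma icrossC B C : icross B C = - icross C B.
Proof. by rewrite /icross; ring. Qed.

End Angles.

Section StartPoint.

Variables (K : fieldType) (l : nat).
Implicit Types (T P : laurent K l) (d v D : int * int).

Lemma st_min d T : T != 0 -> st d T \in Supp (lead_dir d T) /\
  forall a, a \in Supp (lead_dir d T) -> cross (vec d) (st d T) <= cross (vec d) a.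
Proof.
move=> T_neq0; have [e top2_e] := exists_top2 d d T_neq0.
have top_e := is_top2_top top2_e.
have eS : pt l e \in Supp (lead_dir d T).
  by apply: in_imfset; rewrite /= (msupp_lead _ top_e) (proj1 top_e) eqxx.
have tr : transitive (relpre (cross (vec d)) <=%R).
  by move=> a b c; apply: le_trans.
have mem_sorted a : (a \in sorted_lead d T) = (a \in Supp (lead_dir d T)).
  exact: mem_sort.
have srt : sorted (relpre (cross (vec d)) <=%R) (sorted_lead d T).
  by apply: sort_sorted => a b; apply: le_total.
move: eS srt; rewrite /st -mem_sorted; move: mem_sorted.
case: (sorted_lead d T) => // x s mem_sorted _ srt.
split=> [|a]; first by rewrite -mem_sorted mem_head.
rewrite -mem_sorted inE => /predU1P[-> //|a_s].
by have /allP/(_ _ a_s) := order_path_min tr srt.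
Qed.

(* [st d T] is the exponent selected just clockwise of [d]. *)
Lemma st_top2 d v T : 0 < icross v d -> T != 0 ->
  exists2 e, is_top2 d v T e & pt l e = st d T.
Proof.
move=> vd T_neq0; have [stS st_le] := st_min d T_neq0.
have [e0 /is_top2_top top_e0] := exists_top2 d d T_neq0.
have /imfsetP[/= e eL stE] := stS; exists e => //.
move: eL; rewrite (msupp_lead _ top_e0) => /andP[eT /eqP we].
split=> // f fT; have := proj2 top_e0 _ fT; rewrite -we le_eqVlt.
case/predU1P=> [wf|]; [right | by left]; split=> //.
have fS : pt l f \in Supp (lead_dir d T).
  by apply: in_imfset; rewrite /= (msupp_lead _ top_e0) fT wf we eqxx.
have := st_le _ fS; rewrite stE; set a := pt l e; set b := pt l f => cr_le.
have {}wf : wt d b = wt d a by [].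
have vd' : 0 < v.1%:~R * d.2%:~R - v.2%:~R * d.1%:~R :> rat.
  by rewrite -!intrM -intrB ltr0z.
have d_sqr : 0 < d.1%:~R ^+ 2 + d.2%:~R ^+ 2 :> rat.
  rewrite lt_neqAle addr_ge0 ?sqr_ge0 // andbT eq_sym paddr_eq0 ?sqr_ge0 //.
  rewrite !sqrf_eq0; apply: contraTN vd' => /andP[/eqP -> /eqP ->].
  by rewrite !mulr0 subrr ltxx.
rewrite -subr_ge0 -(pmulr_rge0 _ d_sqr).
have -> : (d.1%:~R ^+ 2 + d.2%:~R ^+ 2) * (wt v a - wt v b) =
    (v.1%:~R * d.2%:~R - v.2%:~R * d.1%:~R) *
      (cross (vec d) b - cross (vec d) a) -
    (v.1%:~R * d.1%:~R + v.2%:~R * d.2%:~R) * (wt d b - wt d a).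
  by rewrite /wt /cross /=; ring.
by rewrite wf subrr mulr0 subr0 mulr_ge0 ?(ltW vd') ?subr_ge0.
Qed.

Lemma top_pos (dt d0 : int * int) P :
  (forall d, is_dir d -> angle_le (0, -1) dt d -> angle_le (0, -1) d d0 ->
    (0 < val_dir d P)%E) ->
  forall D f, D.1 != 0 \/ D.2 != 0 ->
    angle_le (0, -1) dt D -> angle_le (0, -1) D d0 ->
    is_top D P f -> 0 < wt D (pt l f).
Proof.
move=> pos D f /exists_dir[g [d [g_gt0 d_dir ->]]].
have [-> _] := angle_le_scale d d0 g_gt0; have [_ ->] := angle_le_scale d dt g_gt0.
move=> le_dt le_d0 [fP max_f].
have wE a : wt (g * d.1, g * d.2) a = g%:~R * wt d a.
  by rewrite /wt /= !intrM; ring.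
have top_d : is_top d P f.
  by split=> // e /max_f; rewrite !wE ler_pM2l ?ltr0z.
have := pos _ d_dir le_dt le_d0; rewrite (val_dir_top top_d) lte_fin => w_gt0.
by rewrite wE mulr_gt0 ?ltr0z.
Qed.

End StartPoint.

Theorem proposition7p3 (K : closedFieldType) (charK : [pchar K] =i pred0)
    (l m n : nat) (l_gt0 : (0 < l)%N) (m_gt1 : (1 < m)%N) (n_gt1 : (1 < n)%N)
    (co_mn : coprime m n)
    (P Q : laurent K l)
    (jacPQ : exists2 c : K, c != 0 & jac P Q = c%:A)
    (ratio11 : (val_dir (1, 1)%R P / val_dir (1, 1)%R Q)%E = (m%:R / n%:R)%:E)
    (ratio01 : (val_dir (0, 1)%R P / val_dir (0, 1)%R Q)%E = (m%:R / n%:R)%:E)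
    (T0 : laurent K l) (T0_gen : subalg_gen P Q T0)
    (d0 : int * int) (d0_ge0 : is_dir_ge0 d0)
    (d0_Dir : Dir P d0) (d0_pos : (0 < val_dir d0 P)%E)
    (st_sim : forall j : nat, iter_jac T0 P j != 0 ->
       cross (st d0 (iter_jac T0 P j)) (st d0 P) = 0)
    (a : int) (b : nat) (b_gt0 : (0 < b)%N)
    (stPQ : m%:R^-1 *: st d0 P = n%:R^-1 *: st d0 Q)
    (stP : m%:R^-1 *: st d0 P = pt l (a, b))
    (lt_ba : b%:R < a%:~R / l%:R :> rat)
    (dt : int * int) (dtP : is_min_pos P d0 dt) :
  forall d : int * int, is_dir d ->
    angle_le (0, -1) dt d -> angle_le (0, -1) d d0 -> d != d0 ->
    forall j : nat,
      jac (lead_dir d (iter_jac T0 P j)) (lead_dir d P) = 0 /\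
      (val_dir d (iter_jac T0 P j) / val_dir d P)%E =
      (val_dir d0 (iter_jac T0 P j) / val_dir d0 P)%E.
Proof.
move=> d d_dir le_dt le_d0 d_neq.
have P_neq0 : P != 0 by apply: contraTneq d0_pos => ->; rewrite val_dir0.
have [d0_dir d0_sum] := andP d0_ge0.
have [[Dir_dt _ pos_arc] _] := dtP; have [dt_dir _] := andP Dir_dt.
have [N] : exists N, iter_jac T0 P N = 0.
  have [c _ cE] := jacPQ; apply: subalg_jac_nilpotent T0_gen.
  by rewrite jacC cE -scaleNr.
have : forall j, iter_jac T0 P j.+1 = jac (iter_jac T0 P j) P by [].
have : forall i j, (i <= j)%N -> iter_jac T0 P i = 0 -> iter_jac T0 P j = 0.
  exact: iter_jac_eq0.
move: (iter_jac T0 P) st_sim => T st_sim T_eq0 TS TN.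
have [A AE] : exists A, st d0 P = A by exists (st d0 P).
have A_lt : A.2 < A.1.
  have m_gt0 : 0 < m%:R :> rat by rewrite ltr0n ltnW.
  have -> : A = m%:R *: pt l (a, b).
    by rewrite -stP AE scalerA mulfV ?scale1r // gt_eqF.
  by rewrite /= /GRing.scale /= ltr_pM2l.
have [V0 V0E] : exists V0, wt d0 A = V0 by exists (wt d0 A).
pose lam j : rat := wt d0 (st d0 (T j)) / V0.
pose kappa : rat := (d0.1 + d0.2)%:~R / V0.
have st_top (S : laurent K l) : S != 0 ->
    exists2 e, is_top d0 S e & pt l e = st d0 S.
  move=> S_neq0; have [v vd0] : exists v, 0 < icross v d0.
    exists (d0.2, - d0.1); rewrite /icross /= mulNr opprK lt_neqAle eq_sym.
    rewrite addr_ge0 -?expr2 ?sqr_ge0 // paddr_eq0 ?sqr_ge0 // !sqrf_eq0 andbT.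
    by rewrite negb_and orbC; apply/orP/dir_neq0.
  by have [e /is_top2_top] := st_top2 vd0 S_neq0; exists e.
have [fA top_fA] := st_top _ P_neq0; rewrite AE => fAE.
have V0_gt0 : 0 < V0.
  by move: d0_pos; rewrite (val_dir_top top_fA) fAE V0E lte_fin.
have lamS j : T j.+1 != 0 -> lam j.+1 <= lam j + 1 - kappa.
  move=> TS_neq0; have T_neq0 : T j != 0.
    by apply: contra_neq TS_neq0; rewrite TS => ->; apply: jac0l.
  have [e top_e eE] := st_top _ T_neq0; have [g top_g gE] := st_top _ TS_neq0.
  have gT : g \in msupp (jac (T j) P) by rewrite -TS; exact: (proj1 top_g).
  have := jac_wt_le l_gt0 top_e top_fA gT.
  rewrite eE gE fAE V0E => le_w.
  have -> : lam j + 1 - kappa =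
      (wt d0 (st d0 (T j)) + V0 - (d0.1 + d0.2)%:~R) / V0.
    by rewrite /lam /kappa; field; rewrite gt_eqF.
  by rewrite ler_pM2r ?invr_gt0.
pose r : seq (int * nat) :=
  enum_fset (msupp P) ++ flatten [seq enum_fset (msupp (T j)) | j <- iota 0 N].
have supp_P : {subset msupp P <= r} by move=> e eP; rewrite mem_cat eP.
have supp_T j : {subset msupp (T j) <= r}.
  move=> e eT; rewrite mem_cat; apply/orP; right; apply/flatten_mapP; exists j => //.
  rewrite mem_iota /= add0n ltnNge; apply: contraTN eT => le_Nj.
  by rewrite (T_eq0 _ _ le_Nj TN) msupp0 in_fset0.
have align v : 0 < icross v d0 -> aligned P T lam d0 v.
  move=> vd0; have [f top2_f] := st_top2 vd0 P_neq0; rewrite AE => fE.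
  exists f => // j T_neq0.
  have [e top2_e eE] := st_top2 vd0 T_neq0; exists e => //.
  apply: (@cross_eq0_scale d0); rewrite ?eE fE ?V0E ?gt_eqF //.
    by rewrite -AE; apply: st_sim.
  by rewrite /lam divfK // gt_eqF.
have slow_arc D : angle_le (0, -1) d D -> angle_le (0, -1) D d0 ->
    D.1 != 0 \/ D.2 != 0 -> D.1 + D.2 < 0 \/ 0 < icross D d0 ->
    slow P kappa D.
  move=> le_dD le_D D_neq0 side f top_f.
  have w_gt0 : 0 < wt D (pt l f).
    apply: (top_pos pos_arc D_neq0 _ le_D top_f).
    exact: angle_le_trans le_dt le_dD.
  split=> //; have s0 : 0 <= (d0.1 + d0.2)%:~R :> rat by rewrite ler0z.
  rewrite /kappa mulrAC ltr_pdivlMr //.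
  case: side => [D_lt0|cr].
    apply: lt_le_trans (_ : 0 <= _); last by rewrite mulr_ge0 // ltW.
    by rewrite pmulr_llt0 // ltrz0.
  apply: lt_le_trans (_ : (d0.1 + d0.2)%:~R * wt D A <= _); last first.
    by rewrite ler_wpM2l // -fAE (proj2 top_f) // (proj1 top_fA).
  rewrite -subr_gt0.
  have -> : (d0.1 + d0.2)%:~R * wt D A - (D.1 + D.2)%:~R * V0 =
      (icross D d0)%:~R * (A.1 - A.2).
    by rewrite -V0E /wt /icross intrB !intrM !intrD; ring.
  by rewrite mulr_gt0 ?ltr0z // subr_gt0.
suff [slow_d prop_d] : slow P kappa d /\ proportional P T lam d.
  have comm_d := proportional_commuting l_gt0 P_neq0 TS lamS slow_d prop_d.
  move=> j; split; first exact: comm_d.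
  have [f /is_top2_top top_f] := exists_top2 d d P_neq0.
  have [wf_gt0 _] := slow_d _ top_f.
  rewrite (val_dir_top top_f) (val_dir_top top_fA) fAE V0E !inver.
  rewrite (gt_eqF wf_gt0) (gt_eqF V0_gt0).
  have [->|T_neq0] := eqVneq (T j) 0.
    by rewrite !val_dir0 !gt0_mulNye ?lte_fin ?invr_gt0.
  have [e /is_top2_top top_e] := exists_top2 d d T_neq0.
  have [e0 top_e0 e0E] := st_top _ T_neq0.
  rewrite (val_dir_top top_e) (val_dir_top top_e0) e0E -!EFinM.
  by rewrite (prop_d _ top_f _ _ top_e) mulfK // gt_eqF.
have walk_arc := walk charK l_gt0 P_neq0 TS supp_P supp_T lamS.
have neq0_cr D : 0 < icross D d0 -> D.1 != 0 \/ D.2 != 0.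
  rewrite /icross => cr; have [D1|] := eqVneq D.1 0; last by left.
  by right; apply: contraTneq cr => ->; rewrite D1 !mul0r ltxx.
have cross_neq0 u v : 0 < icross v u -> cross (vec u) (vec v) != 0.
  by move=> vu; rewrite cross_vec intr_eq0 icrossC oppr_eq0 gt_eqF.
have angle_refl v : angle_le (0, -1) v v.
  rewrite angle_leE; have -> : icross v v = 0 by rewrite /icross mulrC subrr.
  by case: (rightward v); rewrite lexx.
have walk_cone v : is_dir v -> angle_le (0, -1) d v -> angle_le (0, -1) v d0 ->
    0 < icross v d0 -> slow P kappa v /\ proportional P T lam v.
  move=> v_dir le_dv le_v cr.
  split; first by apply: slow_arc; [| |exact: neq0_cr|right].
  apply: walk_arc (align _ cr); first exact: cross_neq0.
  move=> p q p_ge0 q_gt0.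
  have [le_vD le_D crD] := angle_le_cone p_ge0 q_gt0 le_v cr.
  apply: slow_arc le_D _ _; [|exact: neq0_cr | by right].
  exact: angle_le_trans le_dv le_vD.
have [cut|no_cut] := boolP [&& rightward d, ~~ rightward d0 & d.2 < 0].
  have /and3P[rd rd0 d2_lt0] := cut.
  have [_ d02_gt0] := upward d0_dir d0_sum rd0.
  have [slow_u prop_u] : slow P kappa (1, 0) /\ proportional P T lam (1, 0).
    apply: walk_cone; rewrite ?angle_leE ?rd ?(negPf rd0) //.
      by rewrite /icross /= mulr0 sub0r mulr1 oppr_ge0 ltW.
    by rewrite /icross /= mul1r mul0r subr0.
  have comm_u := proportional_commuting l_gt0 P_neq0 TS lamS slow_u prop_u.
  have ud : cross (vec (1, 0)) (vec d) != 0.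
    by apply: cross_neq0; rewrite /icross /= mulr0 sub0r mulr1 oppr_gt0.
  have slow_ud p q : 0 <= p -> 0 < q -> slow P kappa (comb p q (1, 0) d).
    move=> p_ge0 q_gt0.
    have [_ _ _ le_dD le_D] := angle_le_cut p_ge0 q_gt0 rd rd0 d2_lt0 d02_gt0.
    have D2_lt0 : (comb p q (1, 0) d).2 < 0.
      by rewrite /comb /= mulr0 add0r pmulr_rlt0.
    apply: slow_arc le_D _ _ => //; first by right; rewrite lt_eqF.
    have [D_ge0|] := leP 0 ((comb p q (1, 0) d).1 + (comb p q (1, 0) d).2);
      last by left.
    right; have d0_gt0 : 0 < d0.1 + d0.2.
      rewrite lt_neqAle d0_sum andbT eq_sym; apply: contraTneq V0_gt0 => d0_0.
      have -> : V0 = (d0.1 + d0.2)%:~R * A.1 - d0.2%:~R * (A.1 - A.2).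
        by rewrite -V0E /wt intrD; ring.
      by rewrite d0_0 mul0r sub0r oppr_gt0 -leNgt mulr_ge0 // ?ler0z ?subr_ge0 ltW.
    have -> D : icross D d0 = (D.1 + D.2) * d0.2 - D.2 * (d0.1 + d0.2).
      by rewrite /icross; ring.
    by rewrite subr_gt0 (lt_le_trans (_ : _ < 0)) ?nmulr_rlt0 // mulr_ge0 // ltW.
  have algn_u := commuting_aligned charK l_gt0 P_neq0 ud slow_u prop_u comm_u.
  split; last exact: walk_arc ud slow_ud algn_u.
  have dE : comb 0 1 (1, 0) d = d.
    by rewrite /comb !mul0r !mul1r !add0r; case: (d).
  by rewrite -dE; apply: slow_ud.
apply: walk_cone => //; move: le_d0 no_cut; rewrite angle_leE.
case: (boolP (rightward d)) => rd; case: (boolP (rightward d0)) => rd0 //=.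
- rewrite le_eqVlt => /predU1P[/esym cr0|//] _; case/eqP: d_neq.
  by apply: dir_cross_eq0; rewrite // rd rd0.
- have [d01_le0 d02_gt0] := upward d0_dir d0_sum rd0.
  by rewrite -leNgt => _ d2_ge0; apply: icross_upward.
rewrite le_eqVlt => /predU1P[/esym cr0|//] _; case/eqP: d_neq.
by apply: dir_cross_eq0; rewrite // (negPf rd) (negPf rd0).
Qed.
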